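(* Let $c>1$ and let $G_c$ be the connected and simply connected Lie group whose Lie algebra $\mathfrak{g}_c$ has a basis $\{x,y,z\}$ with $[x,y]=0$, $[z,x]=y$, $[z,y]=-cx+2y$. Then any left invariant Lorentzian metric on $G_c$ is equivalent up to automorphism to a metric whose associated matrix (with respect to $\{x,y,z\}$) is of the form $$ \begin{bmatrix}\mu & 0 & 0\\ 0 & 0 & 1\\ 0 & 1 & 0 \end{bmatrix},\quad \begin{bmatrix} 1 & 1 & 0\\ 1 & \tau & 0\\ 0 & 0 & \mu \end{bmatrix},\quad\text{or}\quad \begin{bmatrix} 1 & 1 & 0\\ 1 & \nu & 0\\ 0 & 0 & -\mu \end{bmatrix}, $$ where $\mu>0$, $\tau<1$ and $1<\nu\le c$.
   Context: A left invariant Lorentzian metric $h$ on a connected three-dimensional Lie group $G$ is identified with a nondegenerate symmetric bilinear form of signature $(+,+,-)$ on its Lie algebra $\mathfrak{g}$. With respect to a fixed basis of $\mathfrak{g}$, its associated matrix $[h]$ is the symmetric matrix with $h(u,v)=[u]^t[h][v]$, where $[u]$ is the coordinate column vector of $u$. Two left invariant Lorentzian metrics $h,h'$ on $G$ are equivalent up to automorphism if there is a Lie algebra automorphism $\varphi\in\mathrm{Aut}(\mathfrak{g})$ with $[h']=[\varphi]^t[h][\varphi]$. *)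

(* Defs.v *)
From mathcomp Require Export all_boot all_order all_algebra.
From mathcomp Require Export reals.

Set Implicit Arguments.
Unset Strict Implicit.
Unset Printing Implicit Defensive.

Import Order.TTheory GRing.Theory Num.Theory.
Local Open Scope ring_scope.

Record lie_bracket (F : fieldType) (g : vectType F) := LieBracket {
  bracket :> {bilinear g -> g -> g};
  bracket_alternating : forall u, bracket u u = 0;
  bracket_jacobi : forall u v w,
    bracket u (bracket v w) + bracket v (bracket w u)
      + bracket w (bracket u v) = 0 }.

Definition lie_automorphism (F : fieldType) (g : vectType F)
    (br : lie_bracket g) (phi : 'End(g)) : Prop :=
  bijective phi /\ forall u v, phi (br u v) = br (phi u) (phi v).

(* Signature as in Sylvester's law of inertia: the signs on the diagonal of h
   in some h-orthogonal basis. *)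
Definition signature_ppm (R : realType) (g : vectType R) (h : g -> g -> R) :
    Prop :=
  exists e1 e2 e3 : g,
    [/\ basis_of fullv [tuple e1; e2; e3],
        [/\ h e1 e2 = 0, h e1 e3 = 0 & h e2 e3 = 0],
        0 < h e1 e1, 0 < h e2 e2 & h e3 e3 < 0].

(* A left invariant Lorentzian metric on a three-dimensional Lie group,
   identified with its value at the identity: a form on the Lie algebra g. *)
Record lorentzian_metric (R : realType) (g : vectType R) := LorentzianMetric {
  metric :> {symmetric g};
  metric_nondegenerate : sesquilinear.nondegenerate metric;
  metric_signature : signature_ppm metric }.

Section Coordinates.
Variables (F : fieldType) (g : vectType F) (n : nat) (b : n.-tuple g).

Definition coord_col (u : g) : 'cV[F]_n := \col_i coord b i u.

Definition form_mx (h : g -> g -> F) : 'M[F]_n :=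
  \matrix_(i, j) h b`_i b`_j.

(* Coordinates are columns here, so this is the transpose of the library's
   mxof b b phi. *)
Definition endo_mx (phi : 'End(g)) : 'M[F]_n :=
  \matrix_(i, j) coord b i (phi b`_j).

Hypothesis b_basis : basis_of fullv b.

Lemma coord_basisE u : u = \sum_i coord b i u *: b`_i.
Proof. exact: coord_basis b_basis (memvf u). Qed.

Lemma form_mxE (h : {symmetric g}) u v :
  h u v = ((coord_col u)^T *m form_mx h *m coord_col v) 0 0.
Proof.
rewrite {1}(coord_basisE u) {1}(coord_basisE v) linear_sumr.
rewrite mxE; apply: eq_bigr => j _.
rewrite linear_sumlz !mxE mulr_suml; apply: eq_bigr => i _.
by rewrite linearZlr /= !mxE mulrCA mulrC.
Qed.

Lemma endo_mxE (phi : 'End(g)) u :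
  coord_col (phi u) = endo_mx phi *m coord_col u.
Proof.
apply/colP => i; rewrite !mxE {1}(coord_basisE u) !linear_sum.
by apply: eq_bigr => j _; rewrite !mxE !linearZ /= mulrC.
Qed.

End Coordinates.

Definition equivalent_up_to_automorphism (R : realType) (g : vectType R)
    (br : lie_bracket g) (b : 3.-tuple g) (h h' : lorentzian_metric g) : Prop :=
  exists2 phi : 'End(g), lie_automorphism br phi
    & form_mx b h' = (endo_mx b phi)^T *m form_mx b h *m endo_mx b phi.

Definition mx3 (R : nmodType) (rows : seq (seq R)) : 'M[R]_3 :=
  \matrix_(i, j) (nth [::] rows i)`_j.

(* Main.v *)
(* The plane P = span(x, y) is the derived algebra. As c > 1, ad z has no real
   eigenvalue on P, so P is a complex line on which the endomorphisms commuting
   with ad z act as the complex scalars, and any nonzero such scalar together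
   with any translation z |-> z + p x + q y is an automorphism. If h is
   degenerate on P, a scalar moves y to its null direction there, and a
   translation makes z null and orthogonal to x. Otherwise a translation makes z
   orthogonal to P, and a rotation makes x and (ad z - 1) x orthogonal, i.e.
   h(x, y) = h(x, x). The quarter turn exchanging these two directions where
   necessary, followed by a rescaling, gives h(x, x) = 1 with h(y, y) in the
   required range. *)
Require Import Defs.
From HB Require Import structures.
From mathcomp Require Import ring lra.

Set Implicit Arguments.
Unset Strict Implicit.
Unset Printing Implicit Defensive.

Import Order.TTheory GRing.Theory Num.Theory.
Local Open Scope ring_scope.

(** * Isotropic vectors of binary forms, and 3 by 3 determinants *)

Lemma binary_form_zero (R : rcfType) (a b d : R) :
  4 * a * d <= b ^+ 2 ->
  exists s t, (s != 0) || (t != 0) /\ a * s ^+ 2 + b * s * t + d * t ^+ 2 = 0.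
Proof.
move=> disc; have [->|a0] := eqVneq a 0.
  by exists 1, 0; rewrite oner_eq0; split=> //; ring.
(* Numerator and denominator of the quadratic formula for [s / t]. *)
exists (- b + Num.sqrt (b ^+ 2 - 4 * a * d)), (2 * a).
rewrite [2 * a == 0]mulf_eq0 pnatr_eq0 (negbTE a0) orbT; split=> //.
have sq : Num.sqrt (b ^+ 2 - 4 * a * d) ^+ 2 = b ^+ 2 - 4 * a * d.
  by rewrite sqr_sqrtr // subr_ge0.
by move: sq; set r := Num.sqrt _ => sq; ring: sq.
Qed.

Lemma det3 (R : comNzRingType) (A : 'M[R]_3) :
  \det A = A 0 0 * (A 1 1 * A 2 2 - A 1 2 * A 2 1)
         - A 0 1 * (A 1 0 * A 2 2 - A 1 2 * A 2 0)
         + A 0 2 * (A 1 0 * A 2 1 - A 1 1 * A 2 0).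
Proof.
(* Indexing by naturals lets the nested lifts in the cofactors compute to literals. *)
pose nA (i j : nat) := A (inord i) (inord j).
have nAE i j : A i j = nA i j by rewrite /nA !inord_val.
rewrite (expand_det_row A 0) !big_ord_recl big_ord0 /cofactor.
rewrite !(@expand_det_row _ 2 _ ord0) !big_ord_recl !big_ord0 /cofactor.
by rewrite !det_mx11 !mxE !nAE /= /bump /=; ring.
Qed.

(** * Coordinates with respect to three vectors *)

Section LinearCombinations.
Variables (R : fieldType) (g : vectType R).
Implicit Types u v w t : g.

(** All three coefficients are kept, zeros included, so that [congr comb] turns vector identities
    into ring identities. *)
Definition comb u v w (a b d : R) := a *: u + b *: v + d *: w.

Lemma comb100 u v w : comb u v w 1 0 0 = u.
Proof. by rewrite /comb !scale0r !addr0 scale1r. Qed.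

Lemma comb010 u v w : comb u v w 0 1 0 = v.
Proof. by rewrite /comb !scale0r add0r addr0 scale1r. Qed.

Lemma comb001 u v w : comb u v w 0 0 1 = w.
Proof. by rewrite /comb !scale0r !add0r scale1r. Qed.

Lemma combD u v w a b d a' b' d' :
  comb u v w a b d + comb u v w a' b' d' =
  comb u v w (a + a') (b + b') (d + d').
Proof. by rewrite /comb !scalerDl addrACA [X in X + _]addrACA. Qed.

Lemma combZ u v w k a b d :
  k *: comb u v w a b d = comb u v w (k * a) (k * b) (k * d).
Proof. by rewrite /comb !scalerDr !scalerA. Qed.

Lemma combB u v w a b d a' b' d' :
  comb u v w a b d - comb u v w a' b' d' =
  comb u v w (a - a') (b - b') (d - d').
Proof. by rewrite -scaleN1r combZ combD !mulN1r. Qed.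

Lemma comb_free u v w a b d :
  free [tuple u; v; w] -> comb u v w a b d = 0 -> [/\ a = 0, b = 0 & d = 0].
Proof.
move=> /freeP Fr E; have := Fr (fun i => [:: a; b; d]`_i).
rewrite !big_ord_recl big_ord0 /= addr0 addrA => /(_ E) z.
by split; [exact: (z 0) | exact: (z 1) | exact: (z 2)].
Qed.

Lemma comb_inj u v w a b d a' b' d' :
  free [tuple u; v; w] -> comb u v w a b d = comb u v w a' b' d' ->
  [/\ a = a', b = b' & d = d'].
Proof.
move=> Fr /eqP; rewrite -subr_eq0 combB => /eqP /(comb_free Fr)[? ? ?].
by split; apply/subr0_eq.
Qed.

Lemma free_comb u v w :
  (forall a b d, comb u v w a b d = 0 -> [/\ a = 0, b = 0 & d = 0]) ->
  free [tuple u; v; w].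
Proof.
move=> Fr; apply/freeP => k; rewrite !big_ord_recl big_ord0 /= addr0 addrA.
move=> /Fr[k0 k1 k2] i.
have : i \in [:: 0; 1; 2] by case: i => [[|[|[]]]].
by rewrite !inE => /or3P[] /eqP ->; 
  [exact: k0 | rewrite -[RHS]k1 | rewrite -[RHS]k2];
  congr k; apply/val_inj.
Qed.

Lemma basis_comb u v w u' v' w' :
  basis_of fullv [tuple u; v; w] ->
  (forall a b d, comb u' v' w' a b d = 0 -> [/\ a = 0, b = 0 & d = 0]) ->
  basis_of fullv [tuple u'; v'; w'].
Proof.
move=> B /free_comb Fr; rewrite basisEfree Fr subvf.
by rewrite (leq_trans _ (leqnn 3)) // -(size_basis B).
Qed.

Lemma comb_coord u v w t :
  basis_of fullv [tuple u; v; w] -> exists a b d, t = comb u v w a b d.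
Proof.
move=> /coord_basisE/(_ t); rewrite !big_ord_recl big_ord0 /= addr0 addrA => E.
by do 3!eexists; exact: E.
Qed.

Lemma linear_comb (g' : lmodType R) (f : {linear g -> g'}) u v w a b d :
  f (comb u v w a b d) = a *: f u + b *: f v + d *: f w.
Proof. by rewrite /comb !linearD !linearZ. Qed.

Lemma symC (h : {symmetric g}) u v : h u v = h v u.
Proof. by rewrite hermC expr0 mul1r. Qed.

Lemma form_mx_change n (b e : n.-tuple g) (h : {symmetric g}) :
  basis_of fullv b ->
  let M := \matrix_(i, j) coord b i e`_j in
  form_mx e h = M^T *m form_mx b h *m M.
Proof.
move=> B M; apply/matrixP => i j; rewrite [LHS]mxE (form_mxE B).
rewrite [LHS]mxE [RHS]mxE; apply: eq_bigr => k _; rewrite /M !mxE.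
by congr (_ * _); apply: eq_bigr => l _; rewrite !mxE.
Qed.

Lemma form_comb (h : {symmetric g}) u v w a b d a' b' d' :
  h (comb u v w a b d) (comb u v w a' b' d') =
  a * a' * h u u + b * b' * h v v + d * d' * h w w
  + (a * b' + b * a') * h u v + (a * d' + d * a') * h u w
  + (b * d' + d * b') * h v w.
Proof.
rewrite /comb !linearDl !linearDr /= !linearZlr /=.
rewrite [h v u]symC [h w u]symC [h w v]symC; ring.
Qed.

End LinearCombinations.

(** * Bases with the prescribed structure constants *)

Section AdaptedBases.
Variables (R : realFieldType) (c : R) (g : vectType R) (br : lie_bracket g).
Implicit Types u v w : g.

(** These bases are the images of [x, y, z] under automorphisms, so normalizing a metric amounts to
    choosing one of them. *)
Definition adapted_basis u v w :=
  [/\ basis_of fullv [tuple u; v; w], br u v = 0, br w u = v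
    & br w v = - c *: u + 2 *: v].

Lemma bracket_anticomm u v : br u v = - br v u.
Proof.
apply/eqP; rewrite -addr_eq0; apply/eqP.
have := bracket_alternating br (u + v).
by rewrite linearDl !linearDr /= !bracket_alternating add0r addr0.
Qed.

Lemma bracket_comb u v w a b d a' b' d' : adapted_basis u v w ->
  br (comb u v w a b d) (comb u v w a' b' d') =
  comb u v w (- c * (d * b' - d' * b))
    (d * a' - d' * a + 2 * (d * b' - d' * b)) 0.
Proof.
case=> _ uv wu wv; rewrite [in LHS]/comb !linearDl !linearDr /= !linearZlr /=.
rewrite !bracket_alternating (bracket_anticomm v u) (bracket_anticomm u w).
rewrite (bracket_anticomm v w) uv oppr0 !scaler0 !add0r !addr0.
have -> : br w u = comb u v w 0 1 0 by rewrite comb010.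
have -> : br w v = comb u v w (- c) 2 0 by rewrite wv /comb scale0r addr0.
rewrite -!scaleN1r !combZ !combD; congr comb; ring.
Qed.

(** The second vector is the bracket of [w] with the first; adding [p u + q v] to [w] does not
    change brackets with the abelian plane span(u, v). The last relation is Cayley-Hamilton there:
    [ad w] squared is [2 ad w - c]. *)
Lemma adapted_change u v w (a b p q : R) :
  1 < c -> adapted_basis u v w -> (a != 0) || (b != 0) ->
  adapted_basis (comb u v w a b 0) (comb u v w (- c * b) (a + 2 * b) 0)
    (comb u v w p q 1).
Proof.
move=> c1 uvw ab0; have [basis_uvw uv wu wv] := uvw.
(* The determinant of the change of basis in span(u, v), definite as a form in [a, b] because
   [c > 1]. *)
have det0 : a ^+ 2 + 2 * a * b + c * b ^+ 2 != 0.
  have -> : a ^+ 2 + 2 * a * b + c * b ^+ 2 = (a + b) ^+ 2 + (c - 1) * b ^+ 2.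
    ring.
  have c0 : 0 <= (c - 1) * b ^+ 2 by rewrite mulr_ge0 ?sqr_ge0 ?subr_ge0 ?ltW.
  rewrite paddr_eq0 ?sqr_ge0 //.
  rewrite [_ * _ ^+ 2 == 0]mulf_eq0 !sqrf_eq0 /=.
  rewrite [c - 1 == 0]gt_eqF ?subr_gt0 //= andbC.
  by have [b0|//] := eqVneq b 0; move: ab0; rewrite b0 addr0 eqxx orbF.
split.
- apply: (basis_comb basis_uvw) => k l m.
  rewrite {1}/comb !combZ !combD.
  move=> /(comb_free (basis_free basis_uvw))[E1 E2 E3].
  have m0 : m = 0 by move: E3; rewrite !mulr0 !add0r mulr1.
  move: E1 E2; rewrite m0 !mul0r !addr0 => E1 E2.
  (* Cramer's rule for [E1] and [E2] in the unknowns [k] and [l]. *)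
  split=> //; apply: (mulIf det0); rewrite mul0r.
    transitivity ((a + 2 * b) * (k * a + l * (- c * b))
        + c * b * (k * b + l * (a + 2 * b))).
      ring.
    by rewrite E1 E2 !mulr0 addr0.
  transitivity (a * (k * b + l * (a + 2 * b)) - b * (k * a + l * (- c * b))).
    ring.
  by rewrite E1 E2 !mulr0 subr0.
- rewrite (bracket_comb _ _ _ _ _ _ uvw).
  rewrite -[RHS](scale0r (comb u v w 0 0 0)) combZ.
  congr comb; ring.
- rewrite (bracket_comb _ _ _ _ _ _ uvw); congr comb; ring.
- rewrite (bracket_comb _ _ _ _ _ _ uvw) !combZ combD; congr comb; ring.
Qed.

(** Since the structure constants agree, [bracket_comb] gives the same coefficients on both
    sides. *)
Lemma adapted_automorphism u v w u' v' w' (phi : 'End(g)) :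
  adapted_basis u v w -> adapted_basis u' v' w' ->
  phi u = u' -> phi v = v' -> phi w = w' -> lie_automorphism br phi.
Proof.
move=> uvw uvw' phiu phiv phiw.
have [B _ _ _] := uvw; have [B' _ _ _] := uvw'.
have phiE a b d : phi (comb u v w a b d) = comb u' v' w' a b d.
  by rewrite linear_comb /= phiu phiv phiw.
split.
  have ker0 : lker phi == 0%VS.
    apply/lker0P => s t.
    have [a [b [d ->]]] := comb_coord s B.
    have [a' [b' [d' ->]]] := comb_coord t B.
    by rewrite !phiE => /(comb_inj (basis_free B'))[-> -> ->].
  exists (phi^-1)%VF; [exact: lker0_lfunK | exact: lker0_lfunVK].
move=> s t.
have [a [b [d ->]]] := comb_coord s B.
have [a' [b' [d' ->]]] := comb_coord t B.
rewrite !phiE (bracket_comb _ _ _ _ _ _ uvw).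
by rewrite (bracket_comb _ _ _ _ _ _ uvw') phiE.
Qed.

End AdaptedBases.

(** * Pullback of a Lorentzian metric along a linear bijection *)

Section PulledBackMetric.
Variables (R : realType) (g : vectType R).
Variables (h : lorentzian_metric g) (phi : 'End(g)) (phi_bij : bijective phi).

Definition pullback_form (u v : g) : R := h (phi u) (phi v).

Lemma pullback_bilinear : bilinear_for *%R (idfun \; *%R) pullback_form.
Proof.
by split=> u k v w; rewrite /pullback_form linearP ?linearPl ?linearPr.
Qed.
HB.instance Definition _ := bilinear_isBilinear.Build R g g R _ _
  pullback_form pullback_bilinear.

Lemma pullback_symmetric u v :
  pullback_form u v = (-1) ^+ false * idfun (pullback_form v u).
Proof. by rewrite expr0 mul1r /= /pullback_form symC. Qed.
HB.instance Definition _ := isHermitianSesquilinear.Build R g _ _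
  pullback_form pullback_symmetric.

Lemma pullback_nondegenerate : sesquilinear.nondegenerate pullback_form.
Proof.
have [psi phiK psiK] := phi_bij.
rewrite /sesquilinear.nondegenerate -subv0; apply/subvP => u /mem_orthovP u0.
have : phi u \in orthov h fullv.
  by apply/mem_orthovP => v _; rewrite -(psiK v); exact: u0 (memvf _).
rewrite (eqP (metric_nondegenerate h)) !memv0 => /eqP phiu0.
by rewrite -(phiK u) phiu0 -[X in psi X](linear0 phi) phiK.
Qed.

Lemma pullback_signature : signature_ppm pullback_form.
Proof.
have [psi phiK psiK] := phi_bij.
have [e1 [e2 [e3 [B orth p1 p2 p3]]]] := metric_signature h.
exists (psi e1), (psi e2), (psi e3); rewrite /pullback_form !psiK; split=> //.
apply: (basis_comb B) => a b d E.
apply: (comb_free (basis_free B)).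
by rewrite -(linear0 phi) -E linear_comb /= !psiK.
Qed.

Definition pullback_metric : lorentzian_metric g :=
  LorentzianMetric pullback_nondegenerate pullback_signature.

End PulledBackMetric.

(** * Adapted bases that normalize the metric *)

Section NormalForms.
Variables (R : realType) (c : R) (g : vectType R) (br : lie_bracket g).
Variable h : lorentzian_metric g.
Hypothesis c1 : 1 < c.
Implicit Types u v w : g.

Lemma form_mx3 u v w : form_mx [tuple u; v; w] h =
  mx3 [:: [:: h u u; h u v; h u w];
          [:: h u v; h v v; h v w];
          [:: h u w; h v w; h w w]].
Proof.
apply/matrixP => i j; rewrite !mxE.
by case: i j => [[|[|[|//]]] ?] [[|[|[|//]]] ?] //=; rewrite symC.
Qed.

(** A change of basis multiplies the Gram determinant by a square, so its sign can be read off in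
    the orthogonal basis of the signature. *)
Lemma gram_det_lt0 u v w : basis_of fullv [tuple u; v; w] ->
  h u u * h v v * h w w + 2 * h u v * h v w * h u w
  - h u u * h v w ^+ 2 - h v v * h u w ^+ 2 - h w w * h u v ^+ 2 < 0.
Proof.
move=> B; have [e1 [e2 [e3 [_ [o12 o13 o23] p1 p2 p3]]]] := metric_signature h.
have : \det (form_mx [tuple e1; e2; e3] h) < 0.
  rewrite form_mx3 o12 o13 o23 det3 !mxE /= !mul0r !subr0 !addr0.
  by rewrite pmulr_rlt0 // pmulr_rlt0.
rewrite (form_mx_change _ _ B) !det_mulmx det_tr mulrAC -expr2 => lt0.
have {lt0} : \det (form_mx [tuple u; v; w] h) < 0.
  by move: lt0; rewrite !ltNge; apply: contra => ge0; rewrite mulr_ge0 ?sqr_ge0.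
by rewrite form_mx3 det3 !mxE /=; lra.
Qed.

Lemma metric_pos : exists t, 0 < h t t.
Proof. by have [e1 [? [? [_ _ p1 _ _]]]] := metric_signature h; exists e1. Qed.

Lemma degenerate_normal_form x y z :
  adapted_basis c br x y z -> h x x * h y y = h x y ^+ 2 ->
  exists u v w mu, [/\ adapted_basis c br u v w, 0 < mu &
    form_mx [tuple u; v; w] h =
      mx3 [:: [:: mu; 0; 0]; [:: 0; 0; 1]; [:: 0; 1; 0]]].
Proof.
move=> xyz deg; have c0 : c != 0 by rewrite gt_eqF // (lt_trans ltr01).
(* [s x + t y] is orthogonal to span(x, y): [s, t] is in the kernel of the singular Gram matrix. *)
have [s [t [st0 E1 E2]]] : exists s t, [/\ (s != 0) || (t != 0),
    s * h x x + t * h x y = 0 & s * h x y + t * h y y = 0].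
  have [A0|A0] := eqVneq (h x x) 0.
    exists 1, 0; rewrite oner_eq0 A0; split=> //; first by ring.
    have /eqP : h x y ^+ 2 = 0 by rewrite -deg A0 mul0r.
    by rewrite sqrf_eq0 => /eqP ->; ring.
  exists (- h x y), (h x x); rewrite A0 orbT; split=> //; first by ring.
  by rewrite deg; ring.
have [u [v [uvw uv vv]]] : exists u v, [/\ adapted_basis c br u v z,
    h u v = 0 & h v v = 0].
  (* The coefficients [a, b] of [u] solve [- c b = s] and [a + 2 b = t], so that [v = s x + t y]. *)
  have ab0 : (t + 2 * s / c != 0) || (- s / c != 0).
    move: st0; have [-> /= t0|s0 _] := eqVneq s 0.
      by rewrite mulr0 mul0r addr0 t0.
    by rewrite mulf_neq0 ?orbT ?oppr_eq0 ?invr_eq0.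
  have := adapted_change 0 0 c1 xyz ab0.
  rewrite comb001.
  have -> : - c * (- s / c) = s by field.
  have -> : t + 2 * s / c + 2 * (- s / c) = t by ring.
  move=> uvw; do 2!eexists; split; first exact: uvw.
    rewrite form_comb; transitivity ((t + 2 * s / c) * (s * h x x + t * h x y)
      + (- s / c) * (s * h x y + t * h y y)); first by ring.
    by rewrite E1 E2 !mulr0 addr0.
  rewrite form_comb; transitivity (s * (s * h x x + t * h x y)
    + t * (s * h x y + t * h y y)); first by ring.
  by rewrite E1 E2 !mulr0 addr0.
have [B _ _ _] := uvw.
have := gram_det_lt0 B; rewrite uv vv.
set m := h u u; set k := h v z; set P := h u z; set S := h z z => lt0.
(* The Gram determinant has become [- m k ^+ 2]. *)
have {}lt0 : 0 < m * k ^+ 2 by lra.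
have k0 : k != 0 by apply: contraTneq lt0 => ->; rewrite expr0n mulr0 ltxx.
have m0 : 0 < m by move: lt0; rewrite pmulr_lgt0 // exprn_even_gt0.
(* Scaling by [k^-1] makes the product of the last two vectors 1. The [u]-translation of [z] makes
   it orthogonal to [u], then the [v]-translation makes it null. *)
have a0 : (k^-1 != 0) || ((0 : R) != 0) by rewrite invr_eq0 k0.
have uvw' :=
  adapted_change (- (P / m)) (- (S - P ^+ 2 / m) / (2 * k)) c1 uvw a0.
have mN0 : m != 0 by rewrite gt_eqF.
do 3!eexists; exists (m / k ^+ 2); split; first exact: uvw'.
  by rewrite divr_gt0 // exprn_even_gt0.
rewrite form_mx3 !form_comb uv vv -/m -/k -/P -/S.
by congr mx3; do !congr cons; field; rewrite ?k0.
Qed.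

(** In other words, [u], [v - u], [w] are mutually orthogonal, where [v - u] is [(ad w - 1) u]. *)
Definition normal_pair u v w :=
  [/\ adapted_basis c br u v w, h u v = h u u, h u w = 0 & h v w = 0].

Lemma orthogonal_complement x y z :
  adapted_basis c br x y z -> h x x * h y y != h x y ^+ 2 ->
  exists w, [/\ adapted_basis c br x y w, h x w = 0 & h y w = 0].
Proof.
move=> xyz; rewrite -subr_eq0.
set A := h x x; set B := h x y; set C := h y y => D0.
(* [p x + q y] is minus the orthogonal projection of [z] to span(x, y), by Cramer's rule. *)
pose p := (B * h y z - C * h x z) / (A * C - B ^+ 2).
pose q := (B * h x z - A * h y z) / (A * C - B ^+ 2).
have a0 : ((1 : R) != 0) || ((0 : R) != 0) by rewrite oner_eq0.
have := adapted_change p q c1 xyz a0.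
rewrite !mulr0 addr0 comb100 comb010 => xyw.
exists (comb x y z p q 1); split=> //.
  rewrite -{1}(comb100 x y z) form_comb -/A -/B -/C /p /q; field; exact: D0.
rewrite -{1}(comb010 x y z) form_comb -/A -/B -/C /p /q; field; exact: D0.
Qed.

(* The discriminant of [h u' (v' - u')] as a quadratic form in the
   coefficients [s, t] of [u'] is the sum of squares below: geometrically,
   [v' - u'] is, up to a factor, the quarter turn of [u'] for the complex
   structure on span(x, y) commuting with [ad z]. *)
Lemma normal_pair_exists x y w :
  adapted_basis c br x y w -> h x w = 0 -> h y w = 0 ->
  exists u v, normal_pair u v w.
Proof.
move=> xyw xw yw.
pose A := h x x; pose B := h x y; pose C := h y y.
have [|s [t [st0 E]]] := @binary_form_zero R (B - A) (C - c * A) (C - c * B).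
  rewrite -subr_ge0.
  have -> : (C - c * A) ^+ 2 - 4 * (B - A) * (C - c * B) =
      (C - 2 * B + (2 - c) * A) ^+ 2 + 4 * (c - 1) * (B - A) ^+ 2 by ring.
  have c4 : 0 <= 4 * (c - 1) by rewrite mulr_ge0 ?subr_ge0 ?ltW.
  by apply: addr_ge0; [|apply: mulr_ge0 => //]; exact: sqr_ge0.
have := adapted_change 0 0 c1 xyw st0.
rewrite comb001.
move=> uvw; do 2!eexists; split; first exact: uvw.
- apply/eqP; rewrite -subr_eq0 -E !form_comb xw yw -/A -/B -/C; apply/eqP; ring.
- rewrite -{2}(comb001 x y w) form_comb xw yw; ring.
- rewrite -{2}(comb001 x y w) form_comb xw yw; ring.
Qed.

(** The left side is the product of the squared norms of the orthogonal vectors [u], [v - u],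
    [w]. *)
Lemma normal_pair_gram u v w : normal_pair u v w ->
  h u u * (h v v - h u u) * h w w < 0.
Proof.
move=> [[B _ _ _] uv uw vw]; have := gram_det_lt0 B; rewrite uv uw vw.
by apply: le_lt_trans; rewrite le_eqVlt; apply/orP; left; apply/eqP; ring.
Qed.

(** Take [u' = v - u]. Since [ad w - 1] squares to [1 - c] on the plane, [v' - u' = (1 - c) u],
    which is orthogonal to [u']. *)
Lemma normal_pair_turn u v w : normal_pair u v w ->
  exists u' v', [/\ normal_pair u' v' w, h u' u' = h v v - h u u
    & h v' v' = h v v - h u u + (c - 1) ^+ 2 * h u u].
Proof.
move=> [uvw uv uw vw].
have a0 : ((- 1 : R) != 0) || ((1 : R) != 0) by rewrite oner_eq0 orbT.
have := adapted_change 0 0 c1 uvw a0.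
rewrite comb001.
move=> uvw'; do 2!eexists; split; first split; first exact: uvw'.
- rewrite !form_comb uv uw vw; ring.
- rewrite -{2}(comb001 u v w) form_comb uw vw; ring.
- rewrite -{2}(comb001 u v w) form_comb uw vw; ring.
- rewrite form_comb uv uw vw; ring.
- rewrite form_comb uv uw vw; ring.
Qed.

Lemma normal_pair_scale u v w : normal_pair u v w -> 0 < h u u ->
  exists u' v', adapted_basis c br u' v' w /\
    form_mx [tuple u'; v'; w] h =
      mx3 [:: [:: 1; 1; 0]; [:: 1; h v v / h u u; 0]; [:: 0; 0; h w w]].
Proof.
move=> [uvw uv uw vw] A0.
pose r := Num.sqrt (h u u).
have rr : h u u = r * r by rewrite -expr2 sqr_sqrtr // ltW.
have r0 : r != 0 by rewrite gt_eqF // sqrtr_gt0.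
have a0 : (r^-1 != 0) || ((0 : R) != 0) by rewrite invr_eq0 r0.
have := adapted_change 0 0 c1 uvw a0.
rewrite comb001.
move=> uvw'; do 2!eexists; split; first exact: uvw'.
have planew a b : h (comb u v w a b 0) w = 0.
  rewrite -{2}(comb001 u v w) form_comb uw vw; ring.
rewrite form_mx3 !planew !form_comb uv rr.
by congr mx3; do !congr cons; field.
Qed.

Lemma nondegenerate_normal_form x y z :
  adapted_basis c br x y z -> h x x * h y y != h x y ^+ 2 ->
  exists u v w, adapted_basis c br u v w /\
  ((exists tau mu : R, [/\ tau < 1, 0 < mu & form_mx [tuple u; v; w] h =
      mx3 [:: [:: 1; 1; 0]; [:: 1; tau; 0]; [:: 0; 0; mu]]])
   \/ exists nu mu : R, [/\ 1 < nu, nu <= c, 0 < mu &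
      form_mx [tuple u; v; w] h =
        mx3 [:: [:: 1; 1; 0]; [:: 1; nu; 0]; [:: 0; 0; - mu]]]).
Proof.
move=> xyz /(orthogonal_complement xyz)[w [xyw xw yw]].
have [u [v uvw]] := normal_pair_exists xyw xw yw.
have lt0 := normal_pair_gram uvw.
(* If [h w w] is positive, the plane is Lorentzian and [tau] arises; if negative, the plane is
   definite and [nu] arises. *)
have [S0|S0|S0] := ltrgt0P (h w w); last by move: lt0; rewrite S0 mulr0 ltxx.
  have {}lt0 : h u u * (h v v - h u u) < 0 by rewrite -(pmulr_llt0 _ S0).
  have [u' [v' [uvw' A' lt]]] : exists u' v',
      [/\ normal_pair u' v' w, 0 < h u' u' & h v' v' < h u' u'].
    have [A0|A0|A0] := ltrgt0P (h u u); last by move: lt0; rewrite A0 mul0r ltxx.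
      by exists u, v; split=> //; move: lt0; rewrite pmulr_rlt0 // subr_lt0.
    (* Here [u] is timelike, so [v - u] is spacelike and the turn puts it first. *)
    have [u' [v' [uvw' A' C']]] := normal_pair_turn uvw.
    exists u', v'; rewrite A' C'; split=> //.
      by move: lt0; rewrite nmulr_rlt0.
    by rewrite gtrDl pmulr_rlt0 // exprn_even_gt0 //= subr_eq0 gt_eqF.
  have [u1 [v1 [uvw1 E]]] := normal_pair_scale uvw' A'.
  exists u1, v1, w; split=> //; left; do 2!eexists; split; last exact: E.
    by rewrite ltr_pdivrMr // mul1r.
  exact: S0.
have {}lt0 : 0 < h u u * (h v v - h u u) by rewrite -(nmulr_llt0 _ S0).
(* Otherwise [h] is nonpositive on the orthogonal basis [u], [v - u], [w], hence everywhere,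
   contradicting [metric_pos]. *)
have A0 : 0 < h u u.
  rewrite ltNge; apply/negP => A0.
  have {A0} A0 : h u u < 0.
    rewrite lt_neqAle A0 andbT; apply: contraTneq lt0 => ->.
    by rewrite mul0r ltxx.
  have C0 : h v v - h u u < 0 by move: lt0; rewrite nmulr_rgt0.
  have [e] := metric_pos; have [[B _ _ _] uv uw vw] := uvw.
  have [a [b [d ->]]] := comb_coord e B; rewrite form_comb uv uw vw.
  have -> : a * a * h u u + b * b * h v v + d * d * h w w
      + (a * b + b * a) * h u u + (a * d + d * a) * 0 + (b * d + d * b) * 0 =
    h u u * (a + b) ^+ 2 + (h v v - h u u) * b ^+ 2 + h w w * d ^+ 2 by ring.
  have := mulr_le0_ge0 (ltW A0) (sqr_ge0 (a + b)).
  have := mulr_le0_ge0 (ltW C0) (sqr_ge0 b).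
  have := mulr_le0_ge0 (ltW S0) (sqr_ge0 d).
  lra.
have C0 : h u u < h v v by move: lt0; rewrite pmulr_rgt0 // subr_gt0.
have [u' [v' [uvw' A' lt le]]] : exists u' v', [/\ normal_pair u' v' w,
    0 < h u' u', h u' u' < h v' v' & h v' v' <= c * h u' u'].
  have [le|gt] := leP (h v v) (c * h u u); first by exists u, v.
  have [u' [v' [uvw' A' C']]] := normal_pair_turn uvw.
  exists u', v'; rewrite A' C'; split=> //; first by rewrite subr_gt0.
    by rewrite ltrDl mulr_gt0 // exprn_even_gt0 //= subr_eq0 gt_eqF.
  rewrite -subr_ge0.
  have -> : c * (h v v - h u u) - (h v v - h u u + (c - 1) ^+ 2 * h u u) =
    (c - 1) * (h v v - c * h u u) by ring.
  by rewrite mulr_ge0 // subr_ge0 ltW.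
have [u1 [v1 [uvw1 E]]] := normal_pair_scale uvw' A'.
exists u1, v1, w; split=> //; right; exists (h v' v' / h u' u'), (- h w w).
by rewrite opprK oppr_gt0 ltr_pdivlMr // mul1r ler_pdivrMr.
Qed.

End NormalForms.

(** The linear map from [x, y, z] to [u, v, w] is an automorphism, and [h'] is the pullback of [h]
    along it. A normal form in any adapted basis thus becomes one in the given basis. *)
Lemma equivalent_adapted (R : realType) (c : R) (g : vectType R)
    (br : lie_bracket g) (h : lorentzian_metric g) (x y z u v w : g) :
  adapted_basis c br x y z -> adapted_basis c br u v w ->
  exists2 h' : lorentzian_metric g,
    equivalent_up_to_automorphism br [tuple x; y; z] h h'
  & form_mx [tuple x; y; z] h' = form_mx [tuple u; v; w] h.
Proof.
move=> xyz uvw; have [B _ _ _] := xyz.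
have [f fE] := linear_of_free [:: x; y; z] [:: u; v; w].
have [fx fy fz] := fE (basis_free B) erefl.
pose phi : 'End(g) := linfun f.
have aut : lie_automorphism br phi.
  by apply: (adapted_automorphism xyz uvw); rewrite lfunE.
have h'E : form_mx [tuple x; y; z] (pullback_metric h aut.1)
    = form_mx [tuple u; v; w] h.
  rewrite form_mx3; apply/matrixP => i j; rewrite !mxE /= /pullback_form.
  rewrite !lfunE /=.
  by case: i j => [[|[|[|//]]] ?] [[|[|[|//]]] ?] //=;
     rewrite ?fx ?fy ?fz // symC.
exists (pullback_metric h aut.1) => //; exists phi => //.
rewrite h'E (form_mx_change _ _ B).
have -> : \matrix_(i, j) coord [tuple x; y; z] i [tuple u; v; w]`_j
    = endo_mx [tuple x; y; z] phi => //.
apply/matrixP => i j; rewrite !mxE lfunE /=.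
by case: j => [[|[|[|//]]] ?] /=; rewrite ?fx ?fy ?fz.
Qed.

Theorem theorem3p10 (R : realType) (c : R) (hc : 1 < c)
    (g : vectType R) (br : lie_bracket g) (x y z : g)
    (hbasis : basis_of fullv [tuple x; y; z])
    (hxy : br x y = 0)
    (hzx : br z x = y)
    (hzy : br z y = - c *: x + 2 *: y)
    (h : lorentzian_metric g) :
  exists2 h' : lorentzian_metric g,
    equivalent_up_to_automorphism br [tuple x; y; z] h h'
  & [\/ exists2 mu : R, 0 < mu &
          form_mx [tuple x; y; z] h' =
            mx3 [:: [:: mu; 0; 0];
                    [:: 0; 0; 1];
                    [:: 0; 1; 0]],
        exists tau mu : R, [/\ tau < 1, 0 < mu &
          form_mx [tuple x; y; z] h' =
            mx3 [:: [:: 1; 1; 0];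
                    [:: 1; tau; 0];
                    [:: 0; 0; mu]]]
      | exists nu mu : R, [/\ 1 < nu, nu <= c, 0 < mu &
          form_mx [tuple x; y; z] h' =
            mx3 [:: [:: 1; 1; 0];
                    [:: 1; nu; 0];
                    [:: 0; 0; - mu]]]].
Proof.
have xyz : adapted_basis c br x y z by split.
have [/eqP deg|nondeg] := boolP (h x x * h y y == h x y ^+ 2).
  have [u [v [w [mu [uvw mu0 E]]]]] := degenerate_normal_form hc xyz deg.
  have [h' eqh E'] := equivalent_adapted h xyz uvw.
  by exists h' => //; constructor 1; exists mu => //; rewrite E' E.
have [u [v [w [uvw nf]]]] := nondegenerate_normal_form hc xyz nondeg.
have [h' eqh E'] := equivalent_adapted h xyz uvw.
exists h' => //; rewrite E'.
by case: nf => nf; [constructor 2 | constructor 3].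
Qed.
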